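(* Let $B\in\mathcal{PM}(n)$, $C\in\mathcal{PM}(m)$ and $i\in[n]$. Then: (1) if $A=B\,\square_i\,C$, then $A^*=B^*\,\square_{n-i+1}\,C^*$; (2) if $A=B\circ^{\min}_i C$, then $A^*=B^*\circ^{\max}_{n-i+1}C^*$.
   Context: A poset matrix of order $n$ is an $n\times n$ $(0,1)$-matrix $A=[a_{st}]$ that is lower triangular with all diagonal entries $1$ and transitive ($a_{st}=a_{tu}=1\Rightarrow a_{su}=1$); $\mathcal{PM}(n)$ is the set of these. For $A$ of order $N$, its dual is $A^*=EA^TE$, where $E$ is the $N\times N$ backward identity matrix (ones on the antidiagonal, zeros elsewhere). The poset associated to $B=[b_{st}]\in\mathcal{PM}(m)$ is $[m]$ with $t\le s$ iff $b_{st}=1$. $A[\alpha\mid\beta]$ is the submatrix with rows $\alpha$ and columns $\beta$, $A[\alpha]=A[\alpha\mid\alpha]$. For $A\in\mathcal{PM}(n)$ and $i\in[n]$: $A_{11}=A[\{1..i-1\}]$, $A_{22}=A[\{i+1..n\}]$, $A_{21}=A[\{i+1..n\}\mid\{1..i-1\}]$, $A_{(i)}=A[\{i\}\mid\{1..i-1\}]$, $A^{(i)}=A[\{i+1..n\}\mid\{i\}]$; empty blocks are vacuous. For $B\in\mathcal{PM}(m)$: $A\,\square_i\,B=\begin{pmatrix}A_{11}&\mathbb{O}&\mathbb{O}\\ \mathbb{1}_m^T\otimes A_{(i)}&B&\mathbb{O}\\ A_{21}&\mathbb{1}_m\otimes A^{(i)}&A_{22}\end{pmatrix}$, $A\circ^{\min}_i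 B=\begin{pmatrix}A_{11}&\mathbb{O}&\mathbb{O}\\ \mathbb{1}_m^T\otimes A_{(i)}&B&\mathbb{O}\\ A_{21}&\mathrm{Min}_i(A,B)&A_{22}\end{pmatrix}$, $A\circ^{\max}_i B=\begin{pmatrix}A_{11}&\mathbb{O}&\mathbb{O}\\ \mathrm{Max}_i(A,B)&B&\mathbb{O}\\ A_{21}&\mathbb{1}_m\otimes A^{(i)}&A_{22}\end{pmatrix}$, where $\mathbb{1}_m^T\otimes A_{(i)}$ is the $m\times(i-1)$ matrix with all rows $A_{(i)}$, $\mathbb{1}_m\otimes A^{(i)}$ the $(n-i)\times m$ matrix with all columns $A^{(i)}$, $\mathrm{Min}_i(A,B)$ the $(n-i)\times m$ matrix whose $j$-th column is $A^{(i)}$ if $j$ is minimal in the poset of $B$ and zero otherwise, and $\mathrm{Max}_i(A,B)$ the $m\times(i-1)$ matrix whose $j$-th row is $A_{(i)}$ if $j$ is maximal in the poset of $B$ and zero otherwise. *)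

(* Defs.v *)
From mathcomp Require Import all_boot all_order all_algebra.

Set Implicit Arguments.
Unset Strict Implicit.
Unset Printing Implicit Defensive.

Import Order.TTheory GRing.Theory Num.Theory.
Local Open Scope ring_scope.

(* Indices are 0-based: the mathematical index i \in [n] is the ordinal of value i - 1,
   so that n - i + 1 becomes [rev_ord i], of value n - i.+1. *)

Definition poset_matrix n (A : 'M[int]_n) : Prop :=
  [/\ forall s t, A s t = 0 \/ A s t = 1,
      is_trig_mx A,
      forall s, A s s = 1
    & forall s t u, A s t = 1 -> A t u = 1 -> A s u = 1].

Definition backward_mx n : 'M[int]_n := \matrix_(s, t) (t == rev_ord s)%:R.

Definition dual_mx n (A : 'M[int]_n) : 'M[int]_n :=
  backward_mx n *m A^T *m backward_mx n.

Definition pm_le n (A : 'M[int]_n) : rel 'I_n := fun t s => A s t == 1.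

Definition pm_minimal n (A : 'M[int]_n) (j : 'I_n) : bool :=
  [forall k, pm_le A k j ==> (k == j)].

Definition pm_maximal n (A : 'M[int]_n) (j : 'I_n) : bool :=
  [forall k, pm_le A j k ==> (k == j)].

(* Embeddings onto the indices smaller, resp. larger, than i. *)
Definition before n (i : 'I_n) : 'I_i -> 'I_n := widen_ord (ltnW (ltn_ord i)).

Definition after n (i : 'I_n) (k : 'I_(n - i.+1)) : 'I_n :=
  cast_ord (subnKC (ltn_ord i)) (rshift i.+1 k).

Section Composition.

Variables (n m : nat) (A : 'M[int]_n) (i : 'I_n) (B : 'M[int]_m).

Definition blk11 : 'M[int]_i := mxsub (@before n i) (@before n i) A.
Definition blk22 : 'M[int]_(n - i.+1) := mxsub (@after n i) (@after n i) A.
Definition blk21 : 'M[int]_(n - i.+1, i) := mxsub (@after n i) (@before n i) A.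

(* A_(i) and A^(i) *)
Definition blk_row : 'rV[int]_i := row i (colsub (@before n i) A).
Definition blk_col : 'cV[int]_(n - i.+1) := col i (rowsub (@after n i) A).

Fact composition_order : (i + m + (n - i.+1) = (n + m).-1)%N.
Proof.
by rewrite -[in RHS](subnKC (ltn_ord i)) !addSn /= -addnA [(m + _)%N]addnC addnA.
Qed.

Definition composition (L : 'M[int]_(m, i)) (R : 'M[int]_(n - i.+1, m)) :
    'M[int]_((n + m).-1) :=
  castmx (composition_order, composition_order)
    (block_mx (block_mx blk11 0 L B) 0 (row_mx blk21 R) blk22).

(* Kronecker products of the all-ones vector with A_(i) and A^(i) *)
Definition rep_row : 'M[int]_(m, i) := \matrix_(j, k) blk_row 0 k.
Definition rep_col : 'M[int]_(n - i.+1, m) := \matrix_(k, j) blk_col k 0.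

Definition min_mx : 'M[int]_(n - i.+1, m) :=
  \matrix_(k, j) (if pm_minimal B j then blk_col k 0 else 0).

Definition max_mx : 'M[int]_(m, i) :=
  \matrix_(j, k) (if pm_maximal B j then blk_row 0 k else 0).

Definition square_comp := composition rep_row rep_col.
Definition min_comp := composition rep_row min_mx.
Definition max_comp := composition max_mx rep_col.

End Composition.

(* Main.v *)
Require Import Defs.
From mathcomp Require Import all_boot all_order all_algebra.
From mathcomp Require Import zify.

(* Dualizing reflects a matrix across its antidiagonal. The index reversal of
   [n + m - 1] swaps the outer two of the three index blocks of a composition
   at i and reverses each block, so it carries the composition pattern at i to
   the pattern at n - i + 1, exchanging the blocks L and R; under the same
   reversal, minimal elements of C become maximal elements of C^*. *)

Set Implicit Arguments.
Unset Strict Implicit.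
Unset Printing Implicit Defensive.

Import GRing.Theory.
Local Open Scope ring_scope.

(** Each factor [backward_mx] leaves a single nonzero term in its sum: index [rev_ord t] in the
    outer product, [rev_ord s] in the inner one. *)
Lemma dual_mxE n (A : 'M[int]_n) s t :
  dual_mx A s t = A (rev_ord t) (rev_ord s).
Proof.
rewrite /dual_mx !mxE (bigD1 (rev_ord t)) //= big1 => [|k nk]; last first.
  by rewrite [backward_mx _ _ _]mxE -(inj_eq rev_ord_inj) rev_ordK eq_sym
             (negPf nk) mulr0.
rewrite [backward_mx _ _ _]mxE rev_ordK eqxx mulr1 addr0 mxE.
rewrite (bigD1 (rev_ord s)) //= big1 => [|k nk].
  by rewrite !mxE eqxx mul1r addr0.
by rewrite !mxE (negPf nk) mul0r.
Qed.

(** [rev_ord] is an order-reversing bijection between the relations of [dual_mx A] and [A]; each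
    direction instantiates the other condition at [rev_ord k]. *)
Lemma pm_maximal_dual n (A : 'M[int]_n) j :
  pm_maximal (dual_mx A) j = pm_minimal A (rev_ord j).
Proof.
apply/forallP/forallP => maxj k; have := maxj (rev_ord k);
  by rewrite /pm_le dual_mxE -(inj_eq rev_ord_inj) !rev_ordK.
Qed.

Lemma rep_rowE n m (A : 'M[int]_n) i j k :
  rep_row m A i j k = A i (before k).
Proof. by rewrite !mxE. Qed.

Lemma rep_colE n m (A : 'M[int]_n) i k j :
  rep_col m A i k j = A (after k) i.
Proof. by rewrite !mxE. Qed.

Lemma min_mxE n m (A : 'M[int]_n) i (B : 'M[int]_m) k j :
  min_mx A i B k j = if pm_minimal B j then A (after k) i else 0.
Proof. by rewrite !mxE. Qed.

Lemma max_mxE n m (A : 'M[int]_n) i (B : 'M[int]_m) j k :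
  max_mx A i B j k = if pm_maximal B j then A i (before k) else 0.
Proof. by rewrite !mxE. Qed.

Section CompositionIndices.

Variables (n : nat) (i : 'I_n) (m : nat).

Definition low_idx (k : 'I_i) : 'I_((n + m).-1) :=
  cast_ord (composition_order m i) (lshift _ (lshift _ k)).
Definition mid_idx (j : 'I_m) : 'I_((n + m).-1) :=
  cast_ord (composition_order m i) (lshift _ (rshift _ j)).
Definition high_idx (k : 'I_(n - i.+1)) : 'I_((n + m).-1) :=
  cast_ord (composition_order m i) (rshift _ k).

(** Indexed by the position itself, so that one [case] puts an index in block form throughout the
    goal. *)
Variant composition_idx_spec : 'I_((n + m).-1) -> Type :=
  | LowIdx k : composition_idx_spec (low_idx k)
  | MidIdx j : composition_idx_spec (mid_idx j)
  | HighIdx k : composition_idx_spec (high_idx k).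

Lemma composition_idxP s : composition_idx_spec s.
Proof.
rewrite -(cast_ordKV (composition_order m i) s).
case: (split_ordP (cast_ord (esym (composition_order m i)) s)) => [u ->|k ->]; last exact: HighIdx.
by case: (split_ordP u) => [k ->|j ->]; [apply: LowIdx | apply: MidIdx].
Qed.

Variables (A : 'M[int]_n) (B : 'M[int]_m).
Variables (L : 'M[int]_(m, i)) (R : 'M[int]_(n - i.+1, m)).

Let M := composition A B L R.

(** The nine block equations are bundled so that a single rewrite selects the right one from the
    shapes of the two indices. *)
Lemma compositionE :
  ((forall s t, M (low_idx s) (low_idx t) = A (before s) (before t))
 * (forall s t, M (low_idx s) (mid_idx t) = 0)
 * (forall s t, M (low_idx s) (high_idx t) = 0)
 * (forall s t, M (mid_idx s) (low_idx t) = L s t)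
 * (forall s t, M (mid_idx s) (mid_idx t) = B s t)
 * (forall s t, M (mid_idx s) (high_idx t) = 0)
 * (forall s t, M (high_idx s) (low_idx t) = A (after s) (before t))
 * (forall s t, M (high_idx s) (mid_idx t) = R s t)
 * (forall s t, M (high_idx s) (high_idx t) = A (after s) (after t)))%type.
Proof.
have bE := (castmxE, cast_ordK, block_mxEul, block_mxEur, block_mxEdl,
  block_mxEdr, row_mxEl, row_mxEr).
by do 8?split; move=> s t; rewrite /M !bE // !mxE.
Qed.

End CompositionIndices.

Section DualComposition.

Variables (n m : nat) (i : 'I_n).

(* The index types rely on [rev_ord i] being convertible to [n - i.+1] in nat;
   the reverse identification needs a cast along [rev_ord_gap]. *)
Fact rev_ord_gap : (n - (rev_ord i).+1 = i)%N.
Proof. exact: (congr1 val (rev_ordK i)). Qed.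

Definition rev_low (k : 'I_(rev_ord i)) : 'I_(n - i.+1) := rev_ord k.
Definition rev_high (k : 'I_(n - (rev_ord i).+1)) : 'I_i :=
  rev_ord (cast_ord rev_ord_gap k).

Lemma rev_before k : rev_ord (before k) = after (rev_low k).
Proof. by apply: ord_inj; have /= := ltn_ord k; have := ltn_ord i; lia. Qed.

Lemma rev_after k : rev_ord (after k) = before (rev_high k).
Proof. by apply: ord_inj; have /= := ltn_ord k; have := ltn_ord i; lia. Qed.

Lemma rev_low_idx k : rev_ord (low_idx m k) = high_idx m (rev_low k).
Proof. by apply: ord_inj; have /= := ltn_ord k; have := ltn_ord i; lia. Qed.

Lemma rev_mid_idx j :
  rev_ord (mid_idx (rev_ord i) j) = mid_idx i (rev_ord j : 'I_m).
Proof. by apply: ord_inj; have /= := ltn_ord j; have := ltn_ord i; lia. Qed.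

Lemma rev_high_idx k : rev_ord (high_idx m k) = low_idx m (rev_high k).
Proof. by apply: ord_inj; have /= := ltn_ord k; have := ltn_ord i; lia. Qed.

(** Leaving [L'] and [R'] free up to these entrywise conditions lets the same lemma serve both
    compositions. *)
Lemma dual_composition (A : 'M[int]_n) (B : 'M[int]_m)
    (L : 'M[int]_(m, i)) (R : 'M[int]_(n - i.+1, m))
    (L' : 'M[int]_(m, rev_ord i)) (R' : 'M[int]_(n - (rev_ord i).+1, m)) :
    (forall j k, L' j k = R (rev_low k) (rev_ord j)) ->
    (forall k j, R' k j = L (rev_ord j) (rev_high k)) ->
  dual_mx (composition A B L R) = composition (dual_mx A) (dual_mx B) L' R'.
Proof.
move=> L'E R'E; apply/matrixP=> s t; rewrite dual_mxE.
(* Indices are split at the pivot of the right-hand side; reversal moves them to blocks at pivot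
   [i]. As [s] and [t] are also swapped, the zero blocks above the diagonal match each other. *)
by case: (composition_idxP (rev_ord i) s) => k;
   case: (composition_idxP (rev_ord i) t) => l;
   rewrite !(rev_low_idx, rev_mid_idx, rev_high_idx) !compositionE
           ?dual_mxE ?(rev_before, rev_after) ?L'E ?R'E.
Qed.

End DualComposition.

Theorem theorem10 (n m : nat) (B : 'M[int]_n) (C : 'M[int]_m) (i : 'I_n)
    (hB : poset_matrix B) (hC : poset_matrix C) :
  (forall A : 'M[int]_((n + m).-1),
     A = square_comp B i C ->
     dual_mx A = square_comp (dual_mx B) (rev_ord i) (dual_mx C)) /\
  (forall A : 'M[int]_((n + m).-1),
     A = min_comp B i C ->
     dual_mx A = max_comp (dual_mx B) (rev_ord i) (dual_mx C)).
Proof.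
split=> _ ->; apply: dual_composition => [j k|k j].
- by rewrite rep_rowE rep_colE dual_mxE rev_before rev_ordK.
- by rewrite rep_colE rep_rowE dual_mxE rev_after rev_ordK.
(* Part (2) departs from part (1) only here: row [j] of the max block survives exactly when column
   [rev_ord j] of the min block does. *)
- by rewrite max_mxE min_mxE pm_maximal_dual dual_mxE rev_before rev_ordK.
- by rewrite rep_colE rep_rowE dual_mxE rev_after rev_ordK.
Qed.
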